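(* Let $G$ be a finite simple undirected connected graph with $\operatorname{diam}(G)\geqslant 3$. Then $D_2(G)$ is disconnected if and only if $\hat{G}$ is a bipartite graph.
   Context: All graphs are finite, simple and undirected. $d(x,y)$ is the length of a shortest path between $x$ and $y$, and $\operatorname{diam}(G)$ is the maximum distance between vertices of $G$. The $2$-distance graph $D_2(G)$ has vertex set $V(G)$, and two vertices are adjacent in $D_2(G)$ if and only if their distance in $G$ is exactly $2$. A graph is bipartite if its vertex set is the union of two disjoint non-empty sets $A$ and $B$ such that every edge connects a vertex of $A$ to a vertex of $B$. For $x\in V(G)$, $N(x)$ is the set of vertices adjacent to $x$, and for $A\subseteq V(G)$, $N(A)=\bigcup_{a\in A}N(a)$. A non-empty set $A\subseteq V(G)$ is called Fine if $N(A)\setminus A\neq\emptyset$ and $N(x)\setminus A=N(A)\setminus A$ for every $x\in A$. A maximal Fine set is a Fine set that is maximal with respect to inclusion among Fine sets. If $G$ is connected with $\operatorname{diam}(G)\geqslant 3$, every vertex $x$ lies in a unique maximal Fine set, denoted $\hat{x}$, so the maximal Fine sets partition $V(G)$. The graph $\hat{G}$ has vertex set $\{\hat{x}: x\in V(G)\}$ (the set of maximal Fine sets of $G$), and two distinct vertices $\hat{x},\hat{y}$ are adjacent in $\hat{G}$ if and only if $x$ and $y$ are adjacent in $G$ (this does not depend on the choice of representatives). *)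

(* Defs.v *)
From HB Require Import structures.
From mathcomp Require Import all_boot.

Set Implicit Arguments.
Unset Strict Implicit.
Unset Printing Implicit Defensive.

Record sgraph := SGraph {
  svertex :> finType;
  sedge : rel svertex;
  sedge_sym : symmetric sedge;
  sedge_irr : irreflexive sedge }.

Arguments sedge {G} x y : rename.

Section Graph.
Variable G : sgraph.
Implicit Types (x y : G) (A : {set G}).

Definition connected : Prop := forall x y, connect (@sedge G) x y.

Definition has_walk x y (n : nat) : bool :=
  [exists p : n.-tuple G, path sedge x p && (last x p == y)].

(* A shortest walk has fewer than #|G| edges, so the search range suffices;
   the junk value for unreachable pairs is #|G|. *)
Definition dist x y : nat := find (has_walk x y) (iota 0 #|G|).

(* Only meaningful for connected graphs. *)
Definition diam : nat := \max_(x : G) \max_(y : G) dist x y.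

(* The connectedness conjunct excludes unreachable pairs when #|G| = 2. *)
Definition D2_rel x y : bool := connect sedge x y && (dist x y == 2).

Definition bipartite : Prop :=
  exists A B : {set G},
    [/\ A != set0, B != set0, [disjoint A & B], A :|: B = [set: G] &
        forall x y, sedge x y ->
          (x \in A) && (y \in B) || (x \in B) && (y \in A)].

Definition nbr x : {set G} := [set y | sedge x y].

Definition nbrs A : {set G} := \bigcup_(a in A) nbr a.

Definition Fine A : bool :=
  [&& A != set0, nbrs A :\: A != set0
    & [forall x in A, nbr x :\: A == nbrs A :\: A]].

Definition maxFine A : bool := maxset Fine A.

Definition hat_vertex : finType := {A : {set G} | maxFine A}.

(* Distinct maximal Fine sets of a connected graph of diameter at least 3 are
   completely adjacent or completely non-adjacent, so asking for one adjacent
   pair of representatives is the same as asking for all of them. *)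
Definition hat_rel (A B : hat_vertex) : bool :=
  (A != B) && [exists x in val A, exists y in val B, sedge x y].

Lemma has_walk_sym x y n : has_walk x y n -> has_walk y x n.
Proof.
case/existsP=> p /andP[pp /eqP lp].
have sz : size (rev (belast x p)) == n by rewrite size_rev size_belast size_tuple.
apply/existsP; exists (Tuple sz) => /=; rewrite -lp rev_path.
rewrite (eq_path (e' := sedge)) ?pp => [|u v]; last by rewrite sedge_sym.
by case: (tval p) => //= u s; rewrite rev_cons last_rcons.
Qed.

Lemma dist_sym x y : dist x y = dist y x.
Proof. by apply: eq_find => n; apply/idP/idP; apply: has_walk_sym. Qed.

Lemma dist_refl x : dist x x = 0.
Proof.
rewrite /dist; case: #|G| (ltn0Sn #|G|) (fintype0 (T := G)) => [|m] _ H.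
  by case: (H x).
rewrite /=; case: ifP => // /existsP[].
by exists [tuple]; rewrite /= eqxx.
Qed.

Lemma D2_sym : symmetric D2_rel.
Proof.
by move=> x y; rewrite /D2_rel dist_sym (sym_connect_sym (@sedge_sym G)).
Qed.

Lemma D2_irr : irreflexive D2_rel.
Proof. by move=> x; rewrite /D2_rel dist_refl andbF. Qed.

Lemma hat_sym : symmetric hat_rel.
Proof.
suff H (A B : hat_vertex) : hat_rel A B -> hat_rel B A by move=> A B; apply/idP/idP; apply: H.
rewrite /hat_rel eq_sym => /andP[-> /exists_inP[x xA /exists_inP[y yB xy]]].
by apply/exists_inP; exists y => //; apply/exists_inP; exists x; rewrite // sedge_sym.
Qed.

Lemma hat_irr : irreflexive hat_rel.
Proof. by move=> A; rewrite /hat_rel eqxx. Qed.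

Definition D2 : sgraph := SGraph D2_sym D2_irr.

Definition hat : sgraph := SGraph hat_sym hat_irr.

End Graph.

(* Main.v *)
Require Import Defs.
From mathcomp Require Import all_boot.

(** In a connected graph the Fine sets are exactly the proper non-empty modules
    (sets that no outside vertex splits).  If [diam G >= 3], the complement of
    [G] is connected, so a maximal Fine set contains every proper module that it
    meets, and the maximal Fine sets partition [G].

    If [hat G] is bipartite, two vertices at distance 2 lie in the same maximal
    Fine set or in two sets with a common neighbour in [hat G], hence on the same
    side, so [D2 G] is disconnected.

    Conversely, let [C] be a component of [D2 G].  A vertex outside [C] that is
    adjacent to [u] in [C] is adjacent to all neighbours of [u] in [C], since it
    cannot be at distance 2 from any of them; so the components of the subgraph
    induced on [C], and likewise on its complement, are proper modules.  Hence an
    edge inside [C] or inside its complement stays in one maximal Fine set.  An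
    edge leaving a maximal Fine set [M] goes to a vertex adjacent to all of [M],
    so [M] lies in [C] or in its complement, and these two sides bipartition
    [hat G]. *)

(** * Walks, distances and small diameter *)

Section Distance.
Variable G : sgraph.
Implicit Types x y z : G.

Lemma has_walk0 x y : has_walk x y 0 = (x == y).
Proof.
apply/existsP/eqP => [[p]|->]; last by exists [tuple]; rewrite /= eqxx.
by rewrite (tuple0 p) /= => /eqP.
Qed.

Lemma has_walkS x y n :
  has_walk x y n.+1 = [exists z, sedge x z && has_walk z y n].
Proof.
apply/existsP/existsP => [[p]|[z /andP[xz /existsP[p pP]]]].
  case/tupleP: p => z p /=; rewrite -andbA => /andP[xz pP].
  by exists z; rewrite xz; apply/existsP; exists p.
by exists [tuple of z :: p]; rewrite /= xz.
Qed.

Lemma has_walk1 x y : has_walk x y 1 = sedge x y.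
Proof.
rewrite has_walkS; apply/existsP/idP => [[z]|xy].
  by rewrite has_walk0 => /andP[xz /eqP <-].
by exists y; rewrite has_walk0 eqxx xy.
Qed.

Lemma has_walk2 x y : has_walk x y 2 = [exists z, sedge x z && sedge z y].
Proof. by rewrite has_walkS; apply: eq_existsb => z; rewrite has_walk1. Qed.

Lemma dist_le x y n : has_walk x y n -> dist x y <= n.
Proof.
move=> w; case: (ltnP n #|G|) => nG.
  rewrite leqNgt; apply/negP => /(before_find 0).
  by rewrite nth_iota // add0n w.
(* For [n >= #|G|] the bound is automatic: [find] never exceeds the length [#|G|] of its search
   range. *)
by apply: leq_trans nG; rewrite -[X in _ <= X](size_iota 0 #|G|) find_size.
Qed.

Lemma has_walk_dist x y : connect sedge x y -> has_walk x y (dist x y).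
Proof.
(* A path without repeated vertices has fewer than [#|G|] edges, so the search succeeds. *)
case/connectP=> p0 p0P ->; case/shortenP: p0P => p pP pU _.
have szp : size p < #|G| by have := card_uniqP pU => /= <-; apply: max_card.
have w : has_walk x (last x p) (size p).
  by apply/existsP; exists (in_tuple p); rewrite pP eqxx.
have h : has (has_walk x (last x p)) (iota 0 #|G|).
  by apply/hasP; exists (size p) => //; rewrite mem_iota.
have := nth_find 0 h; rewrite nth_iota ?add0n //.
by rewrite -[X in _ < X](size_iota 0 #|G|) -has_find.
Qed.

Lemma D2_relP x y : connected G ->
  reflect [/\ x != y, ~~ sedge x y & exists z, sedge x z && sedge z y]
          (D2_rel x y).
Proof.
move=> Gconn; rewrite /D2_rel Gconn /=; apply: (iffP eqP) => [d2|[xNy xyN zP]].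
  split.
  - by apply: contra_eq_neq d2 => ->; rewrite dist_refl.
  - apply/negP; rewrite -has_walk1 => /dist_le; by rewrite d2.
  by apply/existsP; rewrite -has_walk2 -d2; apply: has_walk_dist.
have w2 : has_walk x y 2 by rewrite has_walk2; apply/existsP.
have := has_walk_dist _ _ (Gconn x y); have := dist_le _ _ _ w2.
case: (dist x y) => [|[|[|//]]] _; rewrite ?has_walk0 ?has_walk1 //.
  by rewrite (negPf xNy).
by rewrite (negPf xyN).
Qed.

Lemma diam_le2 :
  (forall x y, [|| x == y, sedge x y | [exists z, sedge x z && sedge z y]]) ->
  diam G <= 2.
Proof.
move=> H; apply/bigmax_leqP => x _; apply/bigmax_leqP => y _.
case/or3P: (H x y); rewrite -?has_walk0 -?has_walk1 -?has_walk2 => /dist_le //.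
  by move/leq_trans; apply.
by move/leq_trans; apply.
Qed.

(** Vertices on opposite sides are adjacent; those on the same side share a neighbour on the
    other. *)
Lemma join_diam_le2 (C : {set G}) : C != set0 -> ~: C != set0 ->
  (forall x y, x \in C -> y \notin C -> sedge x y) -> diam G <= 2.
Proof.
case/set0Pn=> c cC /set0Pn[d]; rewrite inE => dC H; apply: diam_le2 => x y.
case: (boolP (x \in C)) (boolP (y \in C)) => xC [] yC.
- by apply/or3P/Or33/existsP; exists d; rewrite (H x) // sedge_sym H.
- by rewrite H // orbT.
- by rewrite sedge_sym H // orbT.
- by apply/or3P/Or33/existsP; exists c; rewrite sedge_sym !H.
Qed.

Lemma diam_card_gt1 : 3 <= diam G -> 1 < #|G|.
Proof.
apply: contraLR; rewrite -leqNgt -ltnNge ltnS => /card_le1_eqP G1.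
by apply: diam_le2 => x y; rewrite (G1 x y) ?eqxx.
Qed.

End Distance.

(** * Modules and maximal Fine sets *)

Section Modules.
Variable G : sgraph.
Implicit Types (x y z : G) (A B M : {set G}).

Definition module A : Prop :=
  forall x y z, x \in A -> y \in A -> z \notin A -> sedge x z = sedge y z.

Lemma module1 x : module [set x].
Proof. by move=> y z w /set1P-> /set1P->. Qed.

Lemma moduleU A B w : w \in A -> w \in B -> module A -> module B ->
  module (A :|: B).
Proof.
move=> wA wB mA mB; suff H x z : x \in A :|: B -> z \notin A :|: B ->
    sedge x z = sedge w z by move=> x y z xAB yAB zAB; rewrite !H.
rewrite !inE negb_or => /orP[xA|xB] /andP[zA zB]; first exact: mA.
exact: mB.
Qed.

Hypothesis Gconn : connected G.

Lemma leaving_edge A : A != set0 -> A != setT ->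
  exists2 x, x \in A & exists2 y, y \notin A & sedge x y.
Proof.
case/set0Pn=> a aA AT; have [/existsP[x /existsP[y /and3P[xA yA xy]]]|] :=
  boolP [exists x, exists y, [&& x \in A, y \notin A & sedge x y]].
  by exists x => //; exists y.
rewrite negb_exists => /forallP H; case/negP: AT; apply/eqP/setP => z.
(* With no edge leaving it, [A] is closed under adjacency and hence everything. *)
have cA : closed (@sedge G) (mem A).
  apply: intro_closed; first exact/sym_connect_sym/sedge_sym.
  move=> x y xy xA; have := H x; rewrite negb_exists => /forallP/(_ y).
  by rewrite xA xy andbT /= negbK.
by rewrite inE -(closed_connect cA (Gconn a z)).
Qed.

(** Connectedness provides an edge leaving any proper non-empty set, so the outer neighbourhood is
    non-empty; the module property makes it common to all members. *)
Lemma FineP A : reflect [/\ A != set0, A != setT & module A] (Fine A).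
Proof.
apply: (iffP and3P) => [[A0 NA /forall_inP H]|[A0 AT mA]].
  split=> // [|x y z xA yA zA].
    by apply: contraNneq NA => ->; rewrite setDT.
  have /eqP := H _ yA; have /eqP <- := H _ xA => /setP/(_ z).
  by rewrite !inE zA.
split=> //.
  have [x xA [y yA xy]] := leaving_edge _ A0 AT.
  by apply/set0Pn; exists y; rewrite inE yA; apply/bigcupP; exists x; rewrite ?inE.
apply/forall_inP => x xA; apply/eqP/setP => z; rewrite !inE.
case: (boolP (z \in A)) => //= zA; apply/idP/bigcupP => [xz|[a aA]].
  by exists x; rewrite ?inE.
by rewrite inE (mA a x).
Qed.

Lemma maxFine_union M A w : maxFine M -> w \in M -> w \in A -> module A ->
  M :|: A != setT -> A \subset M.
Proof.
case/maxsetP=> /FineP[_ _ mM] maxM wM wA mA MAT; apply/setUidPl.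
apply: maxM (subsetUl _ _); apply/FineP; split=> //; last exact: (moduleU _ _ w).
by apply/set0Pn; exists w; rewrite inE wM.
Qed.

Lemma maxFine_cover : 1 < #|G| -> forall x, exists M : hat G, x \in val M.
Proof.
move=> G1 x; have : Fine [set x].
  apply/FineP; split; last exact: module1.
    by apply/set0Pn; exists x; rewrite inE.
  by apply: contraTneq G1 => xT; rewrite -cardsT -xT cards1.
case/maxset_exists => M maxM xM; exists (Sub M maxM : hat G).
by rewrite SubK -sub1set.
Qed.

Hypothesis Gdiam : 3 <= diam G.

(* If [M] and [A] covered [G], an edge leaving [M] would spread, first over [M],
   then over [A], then over [M] again, to a complete join of [M] and [~: M]. *)
Lemma maxFine_absorb M A w : maxFine M -> w \in M -> w \in A -> module A ->
  A != setT -> A \subset M.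
Proof.
move=> maxM wM wA mA AT; have [/FineP[M0 MT mM] _] := maxsetP maxM.
have [/eqP MAT|] := boolP (M :|: A == setT); last exact: maxFine_union wA mA.
have MorA u : (u \in M) || (u \in A) by rewrite -in_setU MAT inE.
have [u uM [p pM up]] := leaving_edge _ M0 MT.
have pA : p \in A by have := MorA p; rewrite (negPf pM).
have [q _ qA] : exists2 q, q \in [set: G] & q \notin A.
  by apply/subsetPn; rewrite subTset.
have qM : q \in M by have := MorA q; rewrite (negPf qA) orbF.
have qp : sedge q p by rewrite (mM q u).
have : diam G <= 2; last by rewrite leqNgt Gdiam.
apply: (join_diam_le2 _ M) => // [|x v xM vM].
  by rewrite -setCT (inj_eq (@setC_inj _)).
have vA : v \in A by have := MorA v; rewrite (negPf vM).
by rewrite (mM x q) // sedge_sym (mA v p) // sedge_sym.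
Qed.

Lemma maxFine_inj M N w : maxFine M -> maxFine N -> w \in M -> w \in N -> M = N.
Proof.
move=> maxM maxN wM wN; apply/eqP; rewrite eqEsubset.
have [[/FineP[_ MT mM] _] [/FineP[_ NT mN] _]] := (maxsetP maxM, maxsetP maxN).
by rewrite (maxFine_absorb N M w) ?(maxFine_absorb M N w).
Qed.

End Modules.

(** * Components induced on a union of [D2] components *)

Section Split.
Variables (G : sgraph) (C : {set G}).
Hypotheses (Gconn : connected G) (Gdiam : 3 <= diam G).
Hypothesis CT : ~: C != set0.
Hypothesis D2C : forall x y, D2_rel x y -> (x \in C) = (y \in C).
Implicit Types (x y z : G) (M : {set G}).

Definition induced_component x : {set G} :=
  [set y | connect [rel u v | [&& u \in C, v \in C & sedge u v]] x y].

Lemma induced_component_refl x : x \in induced_component x.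
Proof. by rewrite inE. Qed.

Lemma induced_component_edge x y : x \in C -> y \in C -> sedge x y ->
  y \in induced_component x.
Proof. by move=> xC yC xy; rewrite inE connect1 //= xC yC. Qed.

Lemma induced_component_sub x : x \in C -> induced_component x \subset C.
Proof.
move=> xC; apply/subsetP => y; rewrite inE => xy.
rewrite -(closed_connect (a := mem C) _ xy) // => u v /and3P[uC vC _].
by rewrite [LHS]uC [RHS]vC.
Qed.

(** Otherwise [x] and [z] are at distance 2 through [y], and [D2C] puts [z] in [C]. *)
Lemma D2_split x y z : x \in C -> y \in C -> z \notin C ->
  sedge x y -> sedge y z -> sedge x z.
Proof.
move=> xC yC zC xy yz; apply/negPn/negP => xzN; have := zC; rewrite -(D2C x) ?xC //.
apply/D2_relP => //; split=> //; last by exists y; rewrite xy.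
by apply: contraNneq zC => <-.
Qed.

Lemma induced_component_module x : x \in C -> module G (induced_component x).
Proof.
move=> xC y z w; have KC := subsetP (induced_component_sub _ xC).
suff H u : u \in induced_component x -> w \notin induced_component x ->
    sedge u w = sedge x w by move=> yK zK wK; rewrite !H.
move=> uK wK; case: (boolP (w \in C)) => wC.
  have KN v : v \in induced_component x -> sedge v w = false.
    move=> vK; apply: contraNF wK => vw; move: (vK); rewrite !inE => /connect_trans.
    by apply; apply: connect1; rewrite /= KC // wC.
  by rewrite !KN // induced_component_refl.
(* For [w] outside [C], adjacency to [w] is preserved along edges inside [C], by [D2_split] in both
   directions. *)
move: uK; rewrite inE => xu; apply/esym.
apply: (closed_connect (a := [pred v | sedge v w]) _ xu) => v t /and3P[vC tC vt].
rewrite !inE; apply/idP/idP => [vw|tw]; last exact: (D2_split v t).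
by apply: (D2_split t v) => //; rewrite sedge_sym.
Qed.

Lemma maxFine_component M x : maxFine M -> x \in M -> x \in C ->
  induced_component x \subset M.
Proof.
move=> maxM xM xC; apply: (maxFine_absorb _ Gconn Gdiam _ _ x) => //.
- exact: induced_component_refl.
- exact: induced_component_module.
apply: contraNneq CT => KT; rewrite -setCT (inj_eq (@setC_inj _)).
by rewrite eqEsubset subsetT -KT induced_component_sub.
Qed.

Lemma maxFine_edge M x y : maxFine M -> x \in M -> x \in C -> y \in C ->
  sedge x y -> y \in M.
Proof.
move=> maxM xM xC yC xy; apply: (subsetP (maxFine_component _ x maxM xM xC)).
exact: induced_component_edge.
Qed.

End Split.

Lemma maxFine_side (G : sgraph) (C M : {set G}) :
  connected G -> 3 <= diam G -> C != set0 -> ~: C != set0 ->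
  (forall x y, D2_rel x y -> (x \in C) = (y \in C)) ->
  maxFine M -> (M \subset C) || (M \subset ~: C).
Proof.
move=> Gconn Gdiam C0 CT D2C maxM; apply/negPn/negP; rewrite negb_or.
case/andP=> /subsetPn[y yM yC] /subsetPn[x xM]; rewrite inE negbK => xC.
have [/FineP[//|M0 MT mM] _] := maxsetP maxM.
have [u uM [z zM uz]] := leaving_edge _ Gconn _ M0 MT.
have Mz v : v \in M -> sedge v z by move=> vM; rewrite (mM v u).
(* The outside vertex [z] is adjacent both to [x] in [C] and to [y] in [~: C], so whichever side
   holds [z], an edge within that side pulls it into [M]. *)
case/negP: zM; case: (boolP (z \in C)) => zC.
  by apply: (maxFine_edge _ C _ _ _ _ _ x); rewrite ?Mz.
apply: (maxFine_edge _ (~: C) _ _ _ _ _ y); rewrite ?inE ?setCK ?Mz //.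
by move=> v w /D2C vw; rewrite !inE vw.
Qed.

(** * The two directions of the equivalence *)

Lemma hat_bipartite (G : sgraph) (C : {set G}) :
  connected G -> 3 <= diam G -> C != set0 -> ~: C != set0 ->
  (forall x y, D2_rel x y -> (x \in C) = (y \in C)) ->
  bipartite (hat G).
Proof.
move=> Gconn Gdiam C0 CT D2C.
have D2C' x y : D2_rel x y -> (x \in ~: C) = (y \in ~: C).
  by move=> /D2C xy; rewrite !inE xy.
have CT' : ~: ~: C != set0 by rewrite setCK.
have [[c cC] [d dC]] := (set0Pn _ C0, set0Pn _ CT).
have G1 := diam_card_gt1 _ Gdiam.
have side (M : hat G) := maxFine_side G C (val M) Gconn Gdiam C0 CT D2C (valP M).
have nonempty (M : hat G) : exists x, x \in val M.
  have [/FineP[//|M0 _ _] _] := maxsetP (valP M); exact/set0Pn.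
have sideN (M : hat G) : (val M \subset ~: C) = ~~ (val M \subset C).
  apply/idP/idP => [MC'|MC]; last by have := side M; rewrite (negPf MC).
  have [x xM] := nonempty M; apply/subsetPn; exists x => //.
  by have := subsetP MC' x xM; rewrite inE.
have cover := maxFine_cover G Gconn G1.
exists [set M : hat G | val M \subset C], [set M : hat G | val M \subset ~: C].
split.
- have [M cM] := cover c; apply/set0Pn; exists M; rewrite inE.
  by apply: contraTT cC; rewrite -sideN => /subsetP/(_ c cM); rewrite inE.
- have [M dM] := cover d; apply/set0Pn; exists M; rewrite inE sideN.
  by apply: contraTN dC => /subsetP/(_ d dM); rewrite inE negbK.
- apply/pred0P => M /=; rewrite !inE sideN; exact: andbN.
- by apply/setP => M; rewrite !inE side.
move=> M N /andP[MN /exists_inP[x xM /exists_inP[y yN xy]]].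
(* Were both ends of a [hat G] edge on one side, [maxFine_edge] would put [y] in [M] as well as in
   [N], forcing [M = N]. *)
have separated (D : {set G}) : ~: D != set0 ->
    (forall u v, D2_rel u v -> (u \in D) = (v \in D)) ->
    val M \subset D -> val N \subset D -> False.
  move=> DT D2D /subsetP MD /subsetP ND; case/eqP: MN; apply: val_inj.
  apply: (maxFine_inj _ Gconn Gdiam _ _ y (valP M) (valP N) _ yN).
  exact: (maxFine_edge _ D Gconn Gdiam DT D2D _ x y (valP M) xM (MD x xM) (ND y yN) xy).
rewrite !inE !sideN; have := separated _ CT D2C; have := separated _ CT' D2C'.
by rewrite !sideN; do 2![case: (_ \subset C)] => //= H1 H2; [case: H2|case: H1].
Qed.

Lemma hat_bipartite_D2 (G : sgraph) :
  connected G -> 3 <= diam G -> bipartite (hat G) -> ~ connected (D2 G).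
Proof.
move=> Gconn Gdiam [A [B [A0 B0 AB ABT Eab]]] D2conn.
have cover := maxFine_cover G Gconn (diam_card_gt1 _ Gdiam).
have overlap (M N : hat G) x : x \in val M -> x \in val N -> M = N.
  move=> xM xN; apply: val_inj.
  exact: (maxFine_inj _ Gconn Gdiam _ _ x (valP M) (valP N)).
have edge_side (M N : hat G) x y : x \in val M -> y \in val N -> sedge x y ->
    M != N -> (M \in A) = (N \notin A).
  move=> xM yN xy MN; have : sedge M N.
    by apply/andP; split=> //; apply/exists_inP; exists x => //; apply/exists_inP; exists y.
  case/Eab/orP=> /andP[]; first by move=> -> /(disjointFl AB) ->.
  by move=> /(disjointFl AB) -> ->.
have nonempty (M : hat G) : exists x, x \in val M.
  by have [/FineP[//|M0 _ _] _] := maxsetP (valP M); apply/set0Pn.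
(* The side [A] pulled back to [G] will be closed under [D2] adjacency, contain [x] and miss [y]. *)
pose C := \bigcup_(M in A) val M.
have D2C x y : D2_rel x y -> x \in C -> y \in C.
  case/D2_relP=> // _ xyN [z /andP[xz zy]] /bigcupP[M MA xM].
  have [N yN] := cover y; have [P zP] := cover z.
  apply/bigcupP; exists N => //.
  have [<-//|MN] := eqVneq M N.
  have split_by (Q : hat G) u v w : u \in val Q -> v \in val Q -> sedge u w ->
      w \notin val Q -> sedge v w.
    have [/FineP[//|_ _ mQ] _] := maxsetP (valP Q).
    by move=> uQ vQ uw wQ; rewrite (mQ v u).
  (* If the midpoint [z] lay in [M], then [y], outside [M] and adjacent to [z], would also be
     adjacent to [x]; [N] is symmetric. *)
  have MP : M != P.
    apply: contraNneq xyN => MP; apply: (split_by M z x) => //; first by rewrite MP.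
    by apply: contra MN => yM; apply/eqP/overlap; last exact: yN.
  have PN : P != N.
    apply: contraNneq xyN => PN; rewrite sedge_sym.
    apply: (split_by N z y); rewrite ?(sedge_sym z) //; first by rewrite -PN.
    by apply: contra MN => xN; apply/eqP/overlap; last exact: xN.
  (* The walk [M], [P], [N] in [hat G] changes side twice, so it ends in [A]. *)
  have := edge_side _ _ _ _ xM zP xz MP; have := edge_side _ _ _ _ zP yN zy PN.
  by rewrite MA => -> /esym; rewrite negbK.
have [[M MA] [N NB]] := (set0Pn _ A0, set0Pn _ B0).
have [[x xM] [y yN]] := (nonempty M, nonempty N).
have cC : closed (@sedge (D2 G)) (mem C).
  apply: intro_closed; first exact/sym_connect_sym/sedge_sym.
  exact: D2C.
have : y \in C.
  by rewrite -(closed_connect cC (D2conn x y)); apply/bigcupP; exists M.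
case/bigcupP=> P PA yP; have := disjointFr AB PA.
by rewrite (overlap P N y) // NB.
Qed.

Theorem theorem2p18 (G : sgraph) (Gconn : connected G) (Gdiam : 3 <= diam G) :
  ~ connected (D2 G) <-> bipartite (hat G).
Proof.
split; last exact: hat_bipartite_D2.
move=> D2N; have : ~~ [forall x, forall y, connect (@sedge (D2 G)) x y].
  by apply/negP => /forallP H; apply: D2N => x y; apply: (forallP (H x)).
rewrite negb_forall => /existsP[x]; rewrite negb_forall => /existsP[y xyN].
(* The [D2] component of [x] is a proper subset because it misses [y]. *)
apply: (hat_bipartite G [set z : G | connect (@sedge (D2 G)) x z]) => //.
- by apply/set0Pn; exists x; rewrite inE.
- by apply/set0Pn; exists y; rewrite !inE.
move=> u v uv; rewrite !inE; apply: same_connect_r; last exact: connect1.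
exact/sym_connect_sym/(@sedge_sym (D2 G)).
Qed.
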